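(* Let $p$ be a positive prime and let $(t,p)$ be a first-degree prime ideal of $\mathbb{Z}[\gamma]$. If either $p=2$ or $t\not\equiv 0\bmod p$, then there exists a unique pair $r,s\in\mathbb{Z}/p\mathbb{Z}$ such that $t\equiv r+s\bmod p$ and $(r,p)$, $(s,p)$ are first-degree prime ideals of $\mathbb{Z}[\alpha]$ and $\mathbb{Z}[\beta]$, respectively.
   Context: Setting: $a,b\in\mathbb{Z}$ have distinct non-trivial square-free parts, $\alpha,\beta\in\mathbb{C}$ satisfy $\alpha^2=a$, $\beta^2=b$ (so $\mathbb{Q}(\alpha)$ and $\mathbb{Q}(\beta)$ are distinct quadratic fields), and $\gamma=\alpha+\beta$, so that $\mathbb{Q}(\gamma)$ is the biquadratic field generated by $\alpha$ and $\beta$. The minimal polynomials over $\mathbb{Q}$ of $\alpha,\beta,\gamma$ are respectively $f_a(x)=x^2-a$, $f_b(x)=x^2-b$, $f_c(x)=x^4-2(a+b)x^2+(a-b)^2$. For an algebraic integer $\theta$, the norm of a non-zero ideal $\mathfrak{a}$ of $\mathbb{Z}[\theta]$ is $[\mathbb{Z}[\theta]:\mathfrak{a}]$, and a non-zero prime ideal of $\mathbb{Z}[\theta]$ is called a first-degree prime ideal if its norm is a prime integer. If $f$ is the minimal polynomial of $\theta$ and $p$ is a positive prime, the prime ideals of $\mathbb{Z}[\theta]$ of norm $p$ are in bijection with the pairs $(r,p)$ with $r\in\mathbb{Z}/p\mathbb{Z}$ and $f(r)\equiv 0 \bmod p$; the pair $(r,p)$ is identified with the kernel of the ring morphism $\pi_\theta:\mathbb{Z}[\theta]\to\mathbb{Z}/p\mathbb{Z}$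 sending $\theta\mapsto r$. Thus ''$(r,p)$ is a first-degree prime ideal of $\mathbb{Z}[\theta]$'' means that $f(r)\equiv 0\bmod p$, and the ideal denoted is this kernel. *)

(* Defs.v *)
From HB Require Import structures.
From mathcomp Require Import all_boot all_order all_algebra.
From mathcomp Require Import classical_sets reals.
From mathcomp.real_closed Require Import complex.

Set Implicit Arguments.
Unset Strict Implicit.
Unset Printing Implicit Defensive.

Import Order.TTheory GRing.Theory Num.Theory.
Local Open Scope classical_set_scope.
Local Open Scope ring_scope.

Definition squarefree (d : int) : Prop :=
  forall k : int, (k ^+ 2 %| d)%Z -> `|k| = 1.

(* [m != 0] is essential: without it every [d] would be a square-free part of
   [0]. As it stands [0] has none, and [d] is unique (and carries the sign of
   [a]) for [a != 0]. *)
Definition squarefree_part (a d : int) : Prop :=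
  squarefree d /\ exists2 m : int, m != 0 & a = d * m ^+ 2.

(* For [K = 'F_p], [evalz f r = 0] reads "f(r) = 0 mod p". *)
Definition evalz (K : nzRingType) (f : {poly int}) (x : K) : K :=
  (map_poly intr f).[x].

(* The minimal polynomial over Q of an algebraic integer has integer
   coefficients, so it is represented in [{poly int}]; irreducibility is over
   Q. *)
Definition is_minpoly (C : numFieldType) (theta : C) (f : {poly int}) : Prop :=
  [/\ f \is monic, evalz f theta = 0
    & irreducible_poly (map_poly intr f : {poly rat})].

Definition first_degree_prime_pair (C : numFieldType) (theta : C) (p : nat)
    (r : 'F_p) : Prop :=
  exists2 f : {poly int}, is_minpoly theta f & evalz f r = 0.

(* What follows makes precise the ideal denoted by a pair; see
   [first_degree_prime_pairP]. *)
Section FirstDegreePrimeIdeals.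
Variables (C : numFieldType) (theta : C).

Definition Zadjoin : set C := [set x | exists f : {poly int}, x = evalz f theta].

Definition is_ideal (I : set C) : Prop :=
  [/\ I `<=` Zadjoin, I 0, forall x y, I x -> I y -> I (x - y)
    & forall x y, Zadjoin x -> I y -> I (x * y)].

Definition is_prime_ideal (I : set C) : Prop :=
  [/\ is_ideal I, ~ I 1
    & forall x y, Zadjoin x -> Zadjoin y -> I (x * y) -> I x \/ I y].

(* [Z[theta] : I] = n, stated by a system of n coset representatives. *)
Definition ideal_norm (I : set C) (n : nat) : Prop :=
  exists c : 'I_n -> C, (forall i, Zadjoin (c i)) /\
    forall x, Zadjoin x -> exists! i, I (x - c i).

Definition first_degree_prime_ideal (I : set C) : Prop :=
  [/\ is_prime_ideal I, exists2 x, I x & x != 0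
    & exists2 p, prime p & ideal_norm I p].

(* The kernel of the morphism Z[theta] -> Z/pZ with theta |-> r, which is well
   defined by [evalz_minpoly_eq]. *)
Definition pair_ideal (p : nat) (r : 'F_p) : set C :=
  [set x | exists2 g : {poly int}, x = evalz g theta & evalz g r = 0].

Fact evalzD (K : nzRingType) (g h : {poly int}) (x : K) :
  evalz (g + h) x = evalz g x + evalz h x.
Proof. by rewrite /evalz rmorphD hornerD. Qed.

Fact evalzB (K : nzRingType) (g h : {poly int}) (x : K) :
  evalz (g - h) x = evalz g x - evalz h x.
Proof. by rewrite /evalz rmorphB hornerD hornerN. Qed.

Fact evalzM (K : comNzRingType) (g h : {poly int}) (x : K) :
  evalz (g * h) x = evalz g x * evalz h x.
Proof. by rewrite /evalz rmorphM hornerM. Qed.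

Fact evalzC (K : nzRingType) (k : int) (x : K) : evalz k%:P x = k%:~R.
Proof. by rewrite /evalz map_polyC hornerC. Qed.

Fact Fp_natr (p : nat) (u : 'F_p) : ((u : nat)%:Z)%:~R = u.
Proof. by rewrite -pmulrn natr_Zp. Qed.

Lemma minpoly_dvd (f g : {poly int}) :
  is_minpoly theta f -> evalz g theta = 0 -> exists q, g = q * f.
Proof.
move=> [fm f0 [_ firr]] g0.
pose r := Pdiv.Ring.rmodp g f; pose q := Pdiv.Ring.rdivp g f.
have gE : g = q * f + r by apply: Pdiv.RingMonic.rdivp_eq.
have r0 : evalz r theta = 0 by move: g0; rewrite gE evalzD evalzM f0 mulr0 add0r.
have rs : (size r < size f)%N by rewrite Pdiv.Ring.ltn_rmodp; apply: monic_neq0.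
exists q; rewrite gE; case: (eqVneq r 0) => [->|rN0]; first by rewrite addr0.
exfalso; pose Q (h : {poly int}) : {poly rat} := map_poly intr h.
have sQ h : size (Q h) = size h by apply: size_map_inj_poly => //; apply: intr_inj.
have QN0 : Q r != 0 by rewrite -size_poly_eq0 sQ size_poly_eq0.
have evQ h : (map_poly ratr (Q h)).[theta] = evalz h theta.
  rewrite /evalz -map_poly_comp; congr (_.[_]); apply: eq_map_poly => z /=.
  by rewrite ratr_int.
have cop : coprimep (Q r) (Q f).
  rewrite /coprimep; apply: contraTT rs => gN1.
  have := firr _ gN1 (dvdp_gcdr _ _) => /eqp_size.
  by rewrite -leqNgt -!sQ => <-; apply: dvdp_leq (dvdp_gcdl _ _).
have /Bezout_eq1_coprimepP[[u v] /= uv] := cop.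
have := congr1 (fun h => (map_poly (ratr : rat -> C) h).[theta]) uv.
rewrite rmorphD !rmorphM rmorph1 hornerD !hornerM hornerC !evQ r0 f0 !mulr0 addr0.
by move/eqP; rewrite eq_sym oner_eq0.
Qed.

Lemma evalz_minpoly_eq (p : nat) (r : 'F_p) (g h : {poly int}) :
  first_degree_prime_pair theta r ->
  evalz g theta = evalz h theta -> evalz g r = evalz h r.
Proof.
move=> [f fmin fr] gh.
have [q qE] : exists q, g - h = q * f.
  by apply: minpoly_dvd; rewrite // evalzB gh subrr.
by apply/eqP; rewrite -subr_eq0 -evalzB qE evalzM fr mulr0.
Qed.

Lemma first_degree_prime_pairP (p : nat) (r : 'F_p) :
  prime p -> (exists f, is_minpoly theta f) ->
  first_degree_prime_pair theta r <->
  first_degree_prime_ideal (pair_ideal r) /\ ideal_norm (pair_ideal r) p.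
Proof.
move=> pp [f fmin].
have kerE : first_degree_prime_pair theta r ->
    forall g, pair_ideal r (evalz g theta) <-> evalz g r = 0.
  by move=> H g; split=> [[h /(evalz_minpoly_eq H) -> //]|g0]; exists g.
split=> [H|]; last first.
  case=> [[[_ N1 _] _ _] _]; exists f => //; case: (eqVneq (evalz f r) 0) => // uN0.
  case: fmin => _ f0 _; case: N1; exists (1%:P - ((evalz f r)^-1 : nat)%:Z%:P * f).
    by rewrite evalzB evalzM f0 mulr0 subr0 evalzC.
  by rewrite evalzB evalzM !evalzC Fp_natr mulVf // subrr.
have {}kerE := kerE H.
have idl : is_ideal (pair_ideal r).
  split=> [x [g -> _]||x y [g -> g0] [h -> h0]|x y [g ->] [h -> h0]].
  - by exists g.
  - by exists 0; rewrite /evalz rmorph0 horner0.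
  - by rewrite -evalzB kerE evalzB g0 h0 subrr.
  - by rewrite -evalzM kerE evalzM h0 mulr0.
have norm : ideal_norm (pair_ideal r) p.
  exists (fun i => evalz (i : nat)%:Z%:P theta); split=> [i|x [g ->]]; first by eexists.
  have lt : (evalz g r < p)%N by rewrite -[X in (_ < X)%N](Fp_cast pp).
  exists (Ordinal lt); split.
    by rewrite -evalzB kerE evalzB evalzC Fp_natr subrr.
  move=> j; rewrite -evalzB kerE evalzB evalzC -pmulrn => /eqP.
  rewrite subr_eq0 => /eqP E; apply: val_inj => /=.
  by rewrite E val_Fp_nat // modn_small.
split=> //; split; last by exists p.
- split=> // [|x y [g ->] [h ->]].
    have -> : 1 = evalz 1%:P theta by rewrite evalzC.
    by rewrite kerE evalzC => /eqP; rewrite oner_eq0.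
  rewrite -evalzM !kerE evalzM => /eqP; rewrite mulf_eq0.
  by case/orP=> /eqP; [left|right].
- exists p%:R; last by rewrite pnatr_eq0 -lt0n prime_gt0.
  exists (p%:Z)%:P; first by rewrite evalzC -pmulrn.
  by rewrite evalzC -pmulrn pchar_Fp_0.
Qed.

End FirstDegreePrimeIdeals.

(* Main.v *)
Require Import Defs.
From mathcomp Require Import all_boot all_order all_algebra.
From mathcomp Require Import reals.
From mathcomp.real_closed Require Import complex.
From mathcomp Require Import ring.

Import GRing.Theory.
Local Open Scope ring_scope.

(** Everything reduces to solving [r + s = t], [r ^+ 2 = a], [s ^+ 2 = b] in
    the field ['F_p].

    The minimal polynomial of an algebraic integer divides, over the integers,
    every integer polynomial vanishing at it; hence the residue of a
    first-degree prime is a root of any such polynomial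
    ([first_degree_prime_pair_root]).  For [gamma = alpha + beta] the relevant
    polynomial yields [t ^+ 4 - 2 (a + b) t ^+ 2 + (a - b) ^+ 2 = 0]; for
    [alpha], whose square [a] is not a rational square, ['X^2 - a] is itself
    minimal, so the pairs of [alpha] are exactly the square roots of [a] modulo
    [p] ([first_degree_prime_pair_sqrt]).

    Subtracting [r ^+ 2 = a] from [(t - r) ^+ 2 = b] leaves the linear equation
    [2 t r = t ^+ 2 + a - b].  When [2 t] is invertible it determines [r], and
    the quartic relation is what makes this [r] a square root of [a]
    ([sum_of_sqrts_unique]).  When [p = 2], squaring is the identity of ['F_2],
    which forces [r = a] and [s = b], while the quartic relation collapses to
    [t = a + b]. *)

Lemma int_sqrt_of_rat (k : int) (y : rat) :
  y ^+ 2 = k%:~R -> exists n : int, k = n ^+ 2.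
Proof.
case: (ratP y) => n d cop.
have dN0 : (d.+1%:Z)%:~R != 0 :> rat by rewrite intr_eq0.
move/(congr1 ( *%R^~ (((d.+1%:Z)%:~R : rat) ^+ 2))).
rewrite expr_div_n mulfVK ?expf_neq0 // -!rmorphXn -rmorphM => /intr_inj nE.
have dvd_d : (d.+1 ^ 2 %| `|n| ^ 2)%N by rewrite -(abszX 2 n) nE abszM dvdn_mull.
(* the squared denominator is coprime to the squared numerator it divides *)
have : coprime (d.+1 ^ 2) (`|n| ^ 2) by rewrite coprimeXl // coprimeXr // coprime_sym.
rewrite /coprime (gcdn_idPl dvd_d) (eqn_exp2r _ 1) // eqSS => /eqP d0.
by exists n; rewrite nE d0 expr1n mulr1.
Qed.

(** Dividing by the square factor, [d] would be the square of an integer [n],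
    and squarefreeness forces [n] to be a unit. *)
Lemma nonsquare_of_squarefree_part (a d : int) (x : rat) :
  squarefree_part a d -> d <> 1 -> x ^+ 2 <> a%:~R.
Proof.
move=> [sqf [m mN0 ->]] dN1 xE.
have mQ : m%:~R != 0 :> rat by rewrite intr_eq0.
have [|n dE] := @int_sqrt_of_rat d (x / m%:~R).
  by rewrite expr_div_n xE rmorphM rmorphXn mulfK // expf_neq0.
have nu : `|n| = 1 by apply: sqf; rewrite dE.
by apply: dN1; rewrite dE -(Num.Theory.real_normK (Num.Theory.num_real n)) nu expr1n.
Qed.

(** The assignment [theta |-> r] is a well-defined morphism on [Z[theta]], so
    it preserves integer polynomial relations. *)
Lemma first_degree_prime_pair_root (C : numFieldType) (theta : C) (p : nat)
    (r : 'F_p) (g : {poly int}) :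
  first_degree_prime_pair theta r -> evalz g theta = 0 -> evalz g r = 0.
Proof.
have evalz0 (K : nzRingType) (x : K) : evalz 0 x = 0 by rewrite evalzC.
move=> pair_r g0; rewrite -(evalz0 _ r).
by apply: (evalz_minpoly_eq pair_r); rewrite g0 evalz0.
Qed.

Lemma evalz_X2subC (K : nzRingType) (a : int) (x : K) :
  evalz ('X^2 - a%:P) x = x ^+ 2 - a%:~R.
Proof. by rewrite /evalz rmorphB /= map_polyXn map_polyC hornerD hornerN hornerXn hornerC. Qed.

(** A quadratic without rational root is irreducible. *)
Lemma is_minpoly_X2subC (C : numFieldType) (theta : C) (a : int) :
  (forall x : rat, x ^+ 2 <> a%:~R) -> theta ^+ 2 = a%:~R ->
  is_minpoly theta ('X^2 - a%:P).
Proof.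
move=> nsq thetaE; split; first exact: monicXnsubC.
  by rewrite evalz_X2subC thetaE subrr.
rewrite rmorphB /= map_polyXn map_polyC /=.
apply: cubic_irreducible => [|x]; first by rewrite size_XnsubC.
by apply/rootP; rewrite !hornerE => /subr0_eq /nsq.
Qed.

Lemma first_degree_prime_pair_sqrt (C : numFieldType) (theta : C) (a : int)
    (p : nat) (r : 'F_p) :
  (forall x : rat, x ^+ 2 <> a%:~R) -> theta ^+ 2 = a%:~R ->
  first_degree_prime_pair theta r <-> r ^+ 2 = a%:~R.
Proof.
move=> nsq thetaE; split=> [pair_r|rE].
  apply/subr0_eq; rewrite -evalz_X2subC.
  by apply: first_degree_prime_pair_root pair_r _; rewrite evalz_X2subC thetaE subrr.
exists ('X^2 - a%:P); first exact: is_minpoly_X2subC.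
by rewrite evalz_X2subC rE subrr.
Qed.

(** The quartic is the product of [X - (x + y)] over the four choices of
    [x = +-alpha] and [y = +-beta], hence it vanishes at [alpha + beta]. *)
Lemma first_degree_prime_pair_sum (C : numFieldType) (alpha beta : C)
    (a b : int) (p : nat) (t : 'F_p) :
  alpha ^+ 2 = a%:~R -> beta ^+ 2 = b%:~R ->
  first_degree_prime_pair (alpha + beta) t ->
  t ^+ 4 - 2 * (a%:~R + b%:~R) * t ^+ 2 + (a%:~R - b%:~R) ^+ 2 = 0.
Proof.
move=> alphaE betaE pair_t.
pose f : {poly int} :=
  'X^4 - (2 * (a + b))%:P * 'X^2 + ((a - b) ^+ 2)%:P.
have evf (K : comNzRingType) (x : K) : evalz f x =
    x ^+ 4 - 2 * (a%:~R + b%:~R) * x ^+ 2 + (a%:~R - b%:~R) ^+ 2.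
  rewrite /f evalzD evalzB (evalzM _ 'X^2) !evalzC /evalz !map_polyXn !hornerXn.
  by ring.
rewrite -evf; apply: first_degree_prime_pair_root pair_t _.
by rewrite evf -alphaE -betaE; ring.
Qed.

Lemma sum_of_sqrts_unique (F : fieldType) (a b t : F) :
  2 != 0 :> F -> t != 0 ->
  t ^+ 4 - 2 * (a + b) * t ^+ 2 + (a - b) ^+ 2 = 0 ->
  exists! rs : F * F, [/\ t = rs.1 + rs.2, rs.1 ^+ 2 = a & rs.2 ^+ 2 = b].
Proof.
move=> two_neq0 t_neq0 quartic.
exists ((t ^+ 2 + a - b) / (2 * t), (t ^+ 2 + b - a) / (2 * t)); split=> /=.
  (* each squared numerator exceeds the square of [2 t] times [a] or [b] by the
     value of the quartic *)
  split; first by field; rewrite two_neq0 t_neq0.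
  - apply/subr0_eq.
    rewrite -[RHS](mul0r ((2 * t) ^- 2)) -quartic.
    by field; rewrite two_neq0 t_neq0.
  - apply/subr0_eq.
    rewrite -[RHS](mul0r ((2 * t) ^- 2)) -quartic.
    by field; rewrite two_neq0 t_neq0.
move=> [r s] /= [tE <- <-]; move: t_neq0; rewrite tE => t_neq0.
by congr pair; field; rewrite two_neq0 t_neq0.
Qed.

(** Here [-1 = (-1) ^+ 2 = 1], so that signs are immaterial. *)
Lemma sum_of_sqrts_unique_idem (F : fieldType) (a b t : F) :
  (forall x : F, x ^+ 2 = x) ->
  t ^+ 4 - 2 * (a + b) * t ^+ 2 + (a - b) ^+ 2 = 0 ->
  exists! rs : F * F, [/\ t = rs.1 + rs.2, rs.1 ^+ 2 = a & rs.2 ^+ 2 = b].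
Proof.
move=> sqE; have oppE (x : F) : - x = x by rewrite -[LHS]sqE sqrrN sqE.
have -> : t ^+ 4 = t by rewrite (exprM t 2 2) !sqE.
have -> : 2 = 0 :> F by rewrite mulr2n -[X in X + _]oppE addNr.
rewrite !mul0r subr0 sqE oppE => /eqP; rewrite addr_eq0 oppE => /eqP tE.
exists (a, b); split=> [|[r s] [_ /= <- <-]] /=; last by rewrite !sqE.
by rewrite !sqE.
Qed.

Theorem theorem3p2 (R : realType) (a b a0 b0 : int) (alpha beta : R[i])
    (ha : squarefree_part a a0) (hb : squarefree_part b b0)
    (ha0 : a0 <> 1) (hb0 : b0 <> 1) (hab : a0 <> b0)
    (halpha : alpha ^+ 2 = a%:~R) (hbeta : beta ^+ 2 = b%:~R)
    (p : nat) (hp : prime p) (t : 'F_p)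
    (ht : first_degree_prime_pair (alpha + beta) t)
    (hpt : p = 2%N \/ t <> 0) :
  exists! rs : 'F_p * 'F_p,
    [/\ t = rs.1 + rs.2,
        first_degree_prime_pair alpha rs.1
      & first_degree_prime_pair beta rs.2].
Proof.
have pairaP (r : 'F_p) := first_degree_prime_pair_sqrt _ _ _ _ r
  (fun x => nonsquare_of_squarefree_part _ _ x ha ha0) halpha.
have pairbP (s : 'F_p) := first_degree_prime_pair_sqrt _ _ _ _ s
  (fun x => nonsquare_of_squarefree_part _ _ x hb hb0) hbeta.
have quartic := first_degree_prime_pair_sum _ _ _ _ _ _ _ halpha hbeta ht.
suff [rs [[tE /pairaP ra /pairbP sb] uniq_rs]] : exists! rs : 'F_p * 'F_p,
    [/\ t = rs.1 + rs.2, rs.1 ^+ 2 = a%:~R & rs.2 ^+ 2 = b%:~R].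
  exists rs; split=> // rs' [tE' /pairaP ra' /pairbP sb'].
  exact: uniq_rs.
have [p2|p_neq2] := eqVneq p 2%N.
  apply: sum_of_sqrts_unique_idem quartic => x.
  by move: x; rewrite p2 => -[[|[|//]] ?]; apply: val_inj.
case: hpt => [p2|/eqP t_neq0]; first by rewrite p2 in p_neq2.
apply: sum_of_sqrts_unique t_neq0 quartic.
by rewrite -(dvdn_pcharf (pchar_Fp hp)) dvdn_prime2.
Qed.
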